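(* Let $n \geq 1$ and $d \in \mathbb{N}$, and let $\mathcal{X}, \mathcal{Y} \subseteq [-1,1]^n$ be finite sample sets that are non-degenerate up to degree $d$, with empirical measures $\mu_{\mathcal{X}}, \mu_{\mathcal{Y}}$ and associated Christoffel polynomials $P^{\mu_{\mathcal{X}}}_d$, $P^{\mu_{\mathcal{Y}}}_d$. Let $C_{n,d} := 4 \cdot s(n,d) \cdot d^2$ with $s(n,d) := \binom{n+d}{d}$. Then $$\|\log P^{\mu_{\mathcal{X}}}_d - \log P^{\mu_{\mathcal{Y}}}_d\|_\infty \leq \log\big(C_{n,d}\cdot \max\{\|P^{\mu_{\mathcal{X}}}_d\|_\infty, \|P^{\mu_{\mathcal{Y}}}_d\|_\infty\}\cdot d_W(\mu_{\mathcal{X}},\mu_{\mathcal{Y}}) + 1\big).$$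
   Context: $\mathbb{R}[\mathbf{x}]_d$ is the space of real polynomials in $n$ variables of total degree at most $d$. For a finite sample set $\mathcal{X}$ consisting of samples $X_1,\dots,X_N$, the empirical measure is $\mu_{\mathcal{X}} = \frac1N\sum_{i=1}^N \delta_{X_i}$, and $\langle p,q\rangle_{\mu_{\mathcal{X}}} := \frac1N\sum_{i=1}^N p(X_i)q(X_i)$. The sample set $\mathcal{X}$ is non-degenerate up to degree $d$ if $\langle\cdot,\cdot\rangle_{\mu_{\mathcal{X}}}$ is positive definite on $\mathbb{R}[\mathbf{x}]_d$ (i.e. no nonzero polynomial of degree at most $d$ vanishes on all samples). In that case, for any orthonormal basis $(b_\alpha)_{|\alpha|\le d}$ of $(\mathbb{R}[\mathbf{x}]_d, \langle\cdot,\cdot\rangle_{\mu_{\mathcal{X}}})$, the Christoffel polynomial is $P^{\mu_{\mathcal{X}}}_d(\mathbf{x}) := \sum_{|\alpha|\le d} b_\alpha(\mathbf{x})^2$ (independent of the choice of basis); it is strictly positive on $\mathbb{R}^n$. Supremum norm: $\|f\|_\infty := \max_{\mathbf{x}\in[-1,1]^n}|f(\mathbf{x})|$. The logarithm is to base 10. Wasserstein distance: for probability measures $\mu_{\mathcal{X}},\mu_{\mathcal{Y}}$ with finite supports $\mathcal{X},\mathcal{Y}$, $d_W(\mu_{\mathcal{X}},\mu_{\mathcal{Y}})$ is the minimum of $\sum_{\mathbf{x}\in\mathcal{X},\mathbf{y}\in\mathcal{Y}}\gamma(\mathbf{x},\mathbf{y})\|\mathbf{x}-\mathbf{y}\|_2$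 over all $\gamma:\mathcal{X}\times\mathcal{Y}\to\mathbb{R}_{\ge0}$ with $\sum_{\mathbf{y}}\gamma(\mathbf{x},\mathbf{y})=\mu_{\mathcal{X}}(\mathbf{x})$ for all $\mathbf{x}\in\mathcal{X}$ and $\sum_{\mathbf{x}}\gamma(\mathbf{x},\mathbf{y})=\mu_{\mathcal{Y}}(\mathbf{y})$ for all $\mathbf{y}\in\mathcal{Y}$. *)

(* Defs.v *)
From HB Require Import structures.
From mathcomp Require Import all_boot all_order all_algebra.
From mathcomp Require Import boolp classical_sets reals exp.
From mathcomp Require Import freeg mpoly.

Set Implicit Arguments.
Unset Strict Implicit.
Unset Printing Implicit Defensive.

Import Order.TTheory GRing.Theory Num.Theory.
Local Open Scope classical_set_scope.
Local Open Scope ring_scope.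

Definition cube (R : realType) (n : nat) : set 'rV[R]_n :=
  [set x | forall i, -1 <= x 0 i <= 1].

(* Mathcomp-analysis norms row vectors with the max norm, hence this one. *)
Definition norm2 (R : realType) (n : nat) (x : 'rV[R]_n) : R :=
  Num.sqrt (\sum_(i < n) x 0 i ^+ 2).

(* The supremum is a maximum when f is continuous on the cube. *)
Definition supnorm (R : realType) (n : nat) (f : 'rV[R]_n -> R) : R :=
  sup [set `|f x| | x in @cube R n].

Definition log10 (R : realType) (x : R) : R := ln x / ln 10%:R.

Definition evalp (R : realType) (n : nat) (p : {mpoly R[n]}) (x : 'rV[R]_n)
  : R := p.@[x 0].

(* [msize p] is 1 + the total degree of p, and 0 when p = 0. *)
Definition deg_le (R : realType) (n d : nat) : set {mpoly R[n]} :=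
  [set p | (msize p <= d.+1)%N].

(* A sample set is the tuple X_1, ..., X_N, repetitions being allowed;
   [empirical X x] is the mass at x of (1/N) \sum_i \delta_(X_i). *)
Definition empirical (R : realType) (n N : nat) (X : N.-tuple 'rV[R]_n)
  (x : 'rV[R]_n) : R :=
  N%:R^-1 * \sum_(i < N) (tnth X i == x)%:R.

Definition sample_inner (R : realType) (n N : nat) (X : N.-tuple 'rV[R]_n)
  (p q : {mpoly R[n]}) : R :=
  N%:R^-1 * \sum_(i < N) evalp p (tnth X i) * evalp q (tnth X i).

(* This excludes N = 0, where [sample_inner] vanishes identically. *)
Definition nondegenerate_upto (R : realType) (n d N : nat)
  (X : N.-tuple 'rV[R]_n) : Prop :=
  forall p : {mpoly R[n]}, deg_le d p -> p != 0 -> 0 < sample_inner X p p.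

(* ['X_{1..n < d.+1}] is the finite type of multi-indices alpha with
   |alpha| <= d. *)
Definition is_basis (R : realType) (n d : nat)
  (b : 'X_{1..n < d.+1} -> {mpoly R[n]}) : Prop :=
  (forall a, deg_le d (b a)) /\
  (forall p : {mpoly R[n]}, deg_le d p ->
     exists! c : {ffun 'X_{1..n < d.+1} -> R}, p = \sum_a c a *: b a).

Definition sample_orthonormal_basis (R : realType) (n d N : nat)
  (X : N.-tuple 'rV[R]_n) : set ('X_{1..n < d.+1} -> {mpoly R[n]}) :=
  [set b | is_basis b /\ forall a a', sample_inner X (b a) (b a') = (a == a')%:R].

(* \sum_alpha b_alpha ^ 2 for some orthonormal basis b; when X is
   non-degenerate up to degree d there is one, and the value does not depend
   on it. *)
Definition christoffel (R : realType) (n d N : nat)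
  (X : N.-tuple 'rV[R]_n) : {mpoly R[n]} :=
  xget 0 [set \sum_a b a ^+ 2 | b in @sample_orthonormal_basis R n d N X].

(* [undup X] enumerates the support of the empirical measure; only the values
   of g on the product of the two supports are relevant. *)
Definition coupling (R : realType) (n N M : nat)
  (X : N.-tuple 'rV[R]_n) (Y : M.-tuple 'rV[R]_n)
  : set ('rV[R]_n -> 'rV[R]_n -> R) :=
  [set g | [/\ forall x y, x \in X -> y \in Y -> 0 <= g x y,
               forall x, x \in X -> \sum_(y <- undup Y) g x y = empirical X x
             & forall y, y \in Y -> \sum_(x <- undup X) g x y = empirical Y y]].

Definition transport_cost (R : realType) (n N M : nat)
  (X : N.-tuple 'rV[R]_n) (Y : M.-tuple 'rV[R]_n)
  (g : 'rV[R]_n -> 'rV[R]_n -> R) : R :=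
  \sum_(x <- undup X) \sum_(y <- undup Y) g x y * norm2 (x - y).

(* The infimum is a minimum: the couplings form a nonempty compact polytope. *)
Definition wasserstein (R : realType) (n N M : nat)
  (X : N.-tuple 'rV[R]_n) (Y : M.-tuple 'rV[R]_n) : R :=
  inf [set transport_cost X Y g | g in coupling X Y].

Definition s_dim (n d : nat) : nat := 'C(n + d, d).

Definition Cnd (R : realType) (n d : nat) : R :=
  4%:R * (s_dim n d)%:R * d%:R ^+ 2.

(* Main.v *)
(* Let q be the reproducing kernel of Y at x: it has degree at most d,
   q(x) = <q, q>_Y = P_Y(x), and q^2 <= P_Y(x) P_Y by Cauchy-Schwarz. By the
   variational characterization of P_X(x),
   P_Y(x)^2 = q(x)^2 <= <q, q>_X P_X(x), and <q, q>_X exceeds <q, q>_Y by at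
   most L d_W, where L is the Lipschitz constant of q^2 on the cube. Moving one
   coordinate at a time, L <= 4 n d^3 P_Y(x) |P_Y| follows from a univariate
   Markov inequality with the non-optimal constant 2 d^3, and
   n d <= s(n, d) absorbs the loss. *)
Require Import Defs.
From HB Require Import structures.
From mathcomp Require Import all_boot all_order all_algebra.
From mathcomp Require Import boolp classical_sets reals exp trigo.
From mathcomp Require Import freeg mpoly.
From mathcomp Require Import ring.

Set Implicit Arguments.
Unset Strict Implicit.
Unset Printing Implicit Defensive.

Import Order.TTheory GRing.Theory Num.Theory.
Local Open Scope classical_set_scope.
Local Open Scope ring_scope.

(** * Trigonometric identities and estimates for multiple angles *)

Lemma cosDcosB (R : realType) (x y : R) :
  cos (x + y) + cos (x - y) = 2 * (cos x * cos y).
Proof. by rewrite cosD cosB; ring. Qed.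

Lemma cos_sub_cos (R : realType) (s t : R) :
  cos s - cos t = - 2 * (sin ((s + t) / 2) * sin ((s - t) / 2)).
Proof.
set x := (s + t) / 2; set y := (s - t) / 2.
have -> : s = x + y by rewrite /x /y; field.
have -> : t = x - y by rewrite /x /y; field.
by rewrite cosD cosB; ring.
Qed.

Lemma normr_sinMn (R : realType) (k : nat) (t : R) :
  `|sin (k%:R * t)| <= k%:R * `|sin t|.
Proof.
elim: k => [|k IHk]; first by rewrite !mul0r sin0 normr0.
rewrite -natr1 !mulrDl !mul1r sinD; apply: (le_trans (ler_normD _ _)).
rewrite !normrM; apply: lerD.
  by rewrite -[leRHS]mulr1; apply: ler_pM; rewrite // ler_norml cos_geN1 cos_le1.
rewrite -[leRHS]mul1r ler_wpM2r //.
by rewrite ler_norml cos_geN1 cos_le1.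
Qed.

(** Both differences factor into sines of the half sum and the half difference, and each sine loses
    a factor [k]. Thus the Chebyshev polynomial $T_k$ is $k^2$-Lipschitz on $[-1,1]$. *)
Lemma normr_cosMnB (R : realType) (k : nat) (s t : R) :
  `|cos (k%:R * s) - cos (k%:R * t)| <= k%:R ^+ 2 * `|cos s - cos t|.
Proof.
rewrite !cos_sub_cos -mulrDr -mulrBr -!mulrA !normrM.
have hD := normr_sinMn k ((s + t) / 2); have hB := normr_sinMn k ((s - t) / 2).
have E (a b c e : R) : a * (a * (b * (c * e))) = b * ((a * c) * (a * e)) by ring.
rewrite E ler_wpM2l // ler_pM // ?normr_ge0.
Qed.

(** Telescoping: $2 \sin x \cos((2j+1)x) = \sin((2j+2)x) - \sin(2jx)$. *)
Lemma sum_cos_odd (R : realType) (N : nat) (x : R) :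
  2 * sin x * (\sum_(j < N) cos (j.*2.+1%:R * x)) = sin (N.*2%:R * x).
Proof.
elim: N => [|N IHN]; first by rewrite big_ord0 mul0r sin0 mulr0.
rewrite big_ord_recr /= mulrDr IHN.
have -> : N.*2%:R * x = N.*2.+1%:R * x - x.
  by rewrite -natr1 mulrDl mul1r addrK.
have -> : N.+1.*2%:R * x = N.*2.+1%:R * x + x.
  by rewrite doubleS -natr1 mulrDl mul1r.
by rewrite sinB sinD; ring.
Qed.

(** * Discrete orthogonality of cosines at the Chebyshev nodes *)

Section Chebyshev.
Variables (R : realType) (N : nat).

(** These are angles; their cosines are the roots of $T_N$. *)
Definition cheb_node (j : nat) : R := j.*2.+1%:R * (pi / N.*2%:R).

(** With $x = m\pi/(2N)$ in $(0,\pi)$, multiplying by $2 \sin x \neq 0$ telescopes the sum to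
    $\sin(m\pi) = 0$. *)
Lemma sum_cos_cheb_node (m : nat) : (0 < m < N.*2)%N ->
  \sum_(j < N) cos (m%:R * cheb_node j) = 0.
Proof.
move=> /andP[m0 mN].
have N0 : (0 : R) < N.*2%:R by rewrite ltr0n (leq_ltn_trans _ mN).
set x : R := m%:R * (pi / N.*2%:R).
have sx : 0 < sin x.
  apply: sin_gt0_pi; apply/andP; split.
    by rewrite mulr_gt0 ?ltr0n // divr_gt0 // pi_gt0.
  rewrite /x mulrCA -[ltRHS]mulr1 ltr_pM2l ?pi_gt0 //.
  by rewrite ltr_pdivrMr // mul1r ltr_nat.
apply: (@mulfI _ (2 * sin x)); first by rewrite mulf_neq0 ?pnatr_eq0 // gt_eqF.
rewrite mulr0; transitivity (sin (N.*2%:R * x)).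
  rewrite -sum_cos_odd; congr (_ * _); apply: eq_bigr => j _.
  by rewrite /cheb_node mulrCA.
have -> : N.*2%:R * x = m%:R * pi by rewrite /x; field; rewrite gt_eqF.
elim: m {m0 mN x sx} => [|m IHm]; first by rewrite mul0r sin0.
by rewrite -natr1 mulrDl mul1r sinDpi IHm oppr0.
Qed.

(** Product-to-sum leaves the frequencies $l+k$ and $|l-k|$, both below $2N$; only $|l-k|$ can be
    zero, as [k] is positive. *)
Lemma cheb_orthogonal (k l : nat) : (0 < k < N)%N -> (l < N)%N ->
  \sum_(j < N) cos (l%:R * cheb_node j) * cos (k%:R * cheb_node j)
  = (k == l)%:R * (N%:R / 2).
Proof.
move=> /andP[k0 kN] lN.
have -> : \sum_(j < N) cos (l%:R * cheb_node j) * cos (k%:R * cheb_node j)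
  = (\sum_(j < N) cos ((l + k)%N%:R * cheb_node j) +
     \sum_(j < N) cos (`|l%:Z - k%:Z|%N%:R * cheb_node j)) / 2.
  rewrite -big_split /= mulr_suml; apply: eq_bigr => j _.
  have -> : cos (`|l%:Z - k%:Z|%N%:R * cheb_node j)
      = cos (l%:R * cheb_node j - k%:R * cheb_node j).
    case: (leqP k l) => kl.
      by rewrite distnEl // natrB // mulrBl.
    by rewrite distnEr 1?ltnW // natrB 1?ltnW // mulrBl -cosN opprB.
  by rewrite natrD [(_ + _) * cheb_node j]mulrDl cosDcosB; field.
rewrite sum_cos_cheb_node ?add0r; last first.
  by rewrite addn_gt0 k0 orbT -addnn -addnS leq_add // ltnW.
have [->|kl] := eqVneq k l.
  rewrite subrr absz0 mul1r (eq_bigr (fun=> 1)) => [|j _].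
    by rewrite sumr_const card_ord.
  by rewrite mul0r cos0.
rewrite sum_cos_cheb_node ?mul0r // absz_gt0 subr_eq0 eqz_nat eq_sym kl /=.
have [kl'|kl'] := leqP k l.
  rewrite distnEl //; apply: leq_ltn_trans (leq_subr _ _) _.
  by rewrite -addnn ltn_addr.
rewrite (distnEr (ltnW kl')); apply: leq_ltn_trans (leq_subr _ _) _.
by rewrite -addnn ltn_addr.
Qed.

End Chebyshev.

(** * Cosine sums and a weak Markov inequality *)

Section CosineSums.
Variables (R : realType) (d : nat).
Implicit Types f g : R -> R.

(** These are the functions $p(\cos t)$ with $p$ a univariate polynomial of degree at most [d],
    expanded in Chebyshev polynomials. *)
Definition cosine_sum f : Prop :=
  exists a : 'I_d.+1 -> R, forall t, f t = \sum_k a k * cos (k%:R * t).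

Lemma cosine_sum_lin c f g : cosine_sum f -> cosine_sum g ->
  cosine_sum (fun t => c * f t + g t).
Proof.
move=> [a fE] [b gE]; exists (fun k => c * a k + b k) => t.
rewrite fE gE mulr_sumr -big_split; apply: eq_bigr => k _ /=; ring.
Qed.

Lemma cosine_sum0 : cosine_sum (fun=> 0).
Proof. by exists (fun=> 0) => t; rewrite big1 // => k _; rewrite mul0r. Qed.

Lemma cosine_sum_comb (I : Type) (r : seq I) (c : I -> R) (F : I -> R -> R) :
  (forall i, cosine_sum (F i)) -> cosine_sum (fun t => \sum_(i <- r) c i * F i t).
Proof.
move=> hF; elim: r => [|i r IHr].
  by under eq_fun do rewrite big_nil; exact: cosine_sum0.
by under eq_fun do rewrite big_cons; exact: cosine_sum_lin.
Qed.

Lemma cosine_sum_cos (k : nat) : (k <= d)%N ->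
  cosine_sum (fun t => cos (k%:R * t)).
Proof.
move=> kd; exists (fun l => (l == k :> nat)%:R) => t.
rewrite (bigD1 (inord k)) //= inordK // eqxx mul1r big1 ?addr0 // => l lk.
case: eqP => [lE|]; last by rewrite mul0r.
by move: lk; rewrite -lE inord_val eqxx.
Qed.

(** The case $k = 0$ is the one wanted; the factor $\cos(kt)$ lets the induction on [m] absorb one
    $\cos t$ at a time by product-to-sum. *)
Lemma cosine_sum_cosXn (k m : nat) : (k + m <= d)%N ->
  cosine_sum (fun t => cos (k%:R * t) * cos t ^+ m).
Proof.
elim: m k => [|m IHm] k km.
  under eq_fun do rewrite expr0 mulr1.
  by apply: cosine_sum_cos; rewrite -[k]addn0.
(* For $k = 0$ there is no frequency $k-1$; one $\cos t$ is instead read as frequency 1. *)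
case: k km => [|k] km.
  have /(_ km) := IHm 1%N; congr cosine_sum; apply/funext => t.
  by rewrite mul0r cos0 !mul1r exprS.
have h1 := IHm k.+2; rewrite !addSn -addnS in h1; move/(_ km) in h1.
have /IHm h2 : (k + m <= d)%N.
  by apply: leq_trans km; rewrite addSn addnS leqW // leqW.
have := cosine_sum_lin 2^-1 h1 (cosine_sum_lin 2^-1 h2 cosine_sum0).
congr cosine_sum; apply/funext => t; rewrite exprSr.
have -> : k.+2%:R * t = k.+1%:R * t + t by rewrite -[k.+2%:R]natr1 mulrDl mul1r.
have -> : k%:R * t = k.+1%:R * t - t.
  by rewrite -[k.+1%:R]natr1 mulrDl mul1r addrK.
have := cosDcosB (k.+1%:R * t) t.
set u := cos _; set v := cos _; set w := cos _; set z := cos _ => E.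
by rewrite (_ : v = 2 * (w * z) - u); [field | rewrite -E; ring].
Qed.

(** By orthogonality on $d+1$ nodes, [a k] is $2/(d+1)$ times the sum of the values at the nodes
    weighted by $\cos(k x_j)$. *)
Lemma cosine_sum_coef_le (a : 'I_d.+1 -> R) (B : R) (k : 'I_d.+1) :
  (forall t, `|\sum_l a l * cos (l%:R * t)| <= B) -> (0 < k)%N ->
  `|a k| <= 2 * B.
Proof.
move=> aB k0; pose x := @cheb_node R d.+1.
have E : \sum_(j < d.+1) (\sum_l a l * cos (l%:R * x j)) * cos (k%:R * x j)
    = a k * (d.+1%:R / 2).
  under eq_bigr do rewrite mulr_suml.
  rewrite exchange_big /= (bigD1 k) //=.
  under eq_bigr do rewrite -mulrA.
  rewrite -mulr_sumr cheb_orthogonal ?k0 ?ltn_ord // eqxx mul1r big1 ?addr0 //.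
  move=> l lk; under eq_bigr do rewrite -mulrA.
  rewrite -mulr_sumr cheb_orthogonal ?k0 ?ltn_ord //.
  by rewrite eq_sym (inj_eq val_inj) (negPf lk) mul0r mulr0.
have : `|a k * (d.+1%:R / 2)| <= d.+1%:R * B.
  rewrite -E; apply: le_trans (ler_norm_sum _ _ _) _.
  apply: (@le_trans _ _ (\sum_(j < d.+1) B)); last first.
    by rewrite sumr_const card_ord mulr_natl.
  apply: ler_sum => j _; rewrite normrM -[leRHS]mulr1 ler_pM //.
  by rewrite ler_norml cos_geN1 cos_le1.
rewrite normrM [X in _ * X]ger0_norm ?divr_ge0 // mulrCA ler_pM2l ?ltr0n //.
by rewrite ler_pdivrMr // mulrC.
Qed.

(* A weak form of Markov's inequality, whose sharp constant is [d ^ 2]: the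
   coefficients are at most [2 * B], and [cos (k t)] is [k ^ 2]-Lipschitz as a
   function of [cos t]. *)
Lemma cosine_sum_lipschitz f (B : R) :
  cosine_sum f -> (forall t, `|f t| <= B) ->
  forall s t, `|f s - f t| <= 2 * d%:R ^+ 3 * B * `|cos s - cos t|.
Proof.
move=> [a fE] fB s t.
have B0 : 0 <= B by apply: le_trans (fB 0).
have aB (k : 'I_d.+1) : (0 < k)%N -> `|a k| <= 2 * B.
  by apply: cosine_sum_coef_le => u; rewrite -fE.
(* The constant term cancels, leaving [d] terms of positive frequency; with $k^2 \le d^2$ this gives
   the cube of [d]. *)
rewrite !fE -sumrB big_ord_recl !mul0r !cos0 subrr add0r.
apply: le_trans (ler_norm_sum _ _ _) _.
apply: (@le_trans _ _ (\sum_(k < d) (2 * B * d%:R ^+ 2 * `|cos s - cos t|))).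
  apply: ler_sum => k _; rewrite -mulrBr normrM -!mulrA [leRHS]mulrA.
  apply: ler_pM => //; first exact: aB.
  apply: le_trans (normr_cosMnB _ _ _) _; rewrite mulrA -expr2 ler_wpM2r //.
  by rewrite ler_pXn2r ?nnegrE ?ler0n // ler_nat lift0 ltn_ord.
rewrite sumr_const card_ord -[leLHS]mulr_natl.
by rewrite le_eqVlt; apply/orP; left; apply/eqP; ring.
Qed.

End CosineSums.

(** * Lipschitz and supremum bounds for polynomials on the cube *)

Section PolynomialsOnCube.
Variables (R : realType) (n : nat).
Implicit Types (x y z : 'rV[R]_n) (p q : {mpoly R[n]}).

Definition set_coord x (i : 'I_n) (t : R) : 'rV[R]_n :=
  \row_j (if j == i then t else x 0 j).

Lemma cube_set_coord x i t : cube x -> -1 <= t <= 1 -> cube (set_coord x i t).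
Proof. by move=> hx ht j; rewrite mxE; case: ifP. Qed.

Lemma cube0 : cube (0 : 'rV[R]_n).
Proof. by move=> i; rewrite mxE lerN10 ler01. Qed.

Lemma ler_norm_norm2 x i : `|x 0 i| <= norm2 x.
Proof.
rewrite -sqrtr_sqr ler_wsqrtr // (bigD1 i) //= lerDl.
by apply: sumr_ge0 => j _; exact: sqr_ge0.
Qed.

Lemma norm2_ge0 x : 0 <= norm2 x.
Proof. exact: sqrtr_ge0. Qed.

Lemma evalp_sum (d : nat) p x : deg_le d p ->
  evalp p x = \sum_(m : 'X_{1..n < d.+1}) p@_m * \prod_j x 0 j ^+ m j.
Proof.
move=> hp; rewrite /evalp [in LHS](mpolywE hp) raddf_sum /=.
by apply: eq_bigr => m _; rewrite mevalZ mevalX.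
Qed.

(** With the other coordinates frozen, each monomial becomes a constant times a power of $\cos t$
    with exponent at most [d]. *)
Lemma evalp_cosine_sum (d : nat) p x i : deg_le d p ->
  cosine_sum d (fun t => evalp p (set_coord x i (cos t))).
Proof.
move=> hp.
have /(_ (fun m : 'X_{1..n < d.+1} => p@_m * \prod_(j | j != i) x 0 j ^+ m j)) :=
  @cosine_sum_comb R d 'X_{1..n < d.+1} (index_enum _) _
    (fun m t => cos t ^+ (m : 'X_{1..n}) i).
case=> [m|a aE].
  have /(@cosine_sum_cosXn R d 0) : (0 + (m : 'X_{1..n}) i <= d)%N.
    rewrite add0n -ltnS (leq_ltn_trans _ (bmdeg m)) //.
    by rewrite mdegE (bigD1 i) //= leq_addr.
  by congr cosine_sum; apply/funext => t; rewrite mul0r cos0 mul1r.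
exists a => t; rewrite -aE (evalp_sum _ hp); apply: eq_bigr => m _.
rewrite -mulrA; congr (_ * _); rewrite (bigD1 i) //= mxE eqxx mulrC.
by congr (_ * _); apply: eq_bigr => j /negPf ji; rewrite mxE ji.
Qed.

Lemma evalp_coord_lipschitz (d : nat) p x i (B s t : R) :
  deg_le d p -> (forall z, cube z -> `|evalp p z| <= B) -> cube x ->
  -1 <= s <= 1 -> -1 <= t <= 1 ->
  `|evalp p (set_coord x i s) - evalp p (set_coord x i t)|
    <= 2 * d%:R ^+ 3 * B * `|s - t|.
Proof.
move=> hp pB hx hs ht.
(* Writing [s] and [t] as cosines reduces the claim to cosine sums; every angle gives a point of the
   cube, so [B] bounds the whole sum. *)
rewrite -(@acosK _ s) ?inE // -(@acosK _ t) ?inE //.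
apply: (cosine_sum_lipschitz (evalp_cosine_sum x i hp)).
by move=> u; apply/pB/cube_set_coord; rewrite ?cos_geN1 ?cos_le1.
Qed.

Lemma evalp_lipschitz (d : nat) p (B : R) x y :
  deg_le d p -> (forall z, cube z -> `|evalp p z| <= B) -> cube x -> cube y ->
  `|evalp p x - evalp p y| <= n%:R * (2 * d%:R ^+ 3 * B * norm2 (x - y)).
Proof.
move=> hp pB hx hy.
have B0 : 0 <= B by apply: le_trans (pB 0 cube0).
(* A path from [x] to [y] inside the cube: step [k] changes only coordinate [k], by at most
   [norm2 (x - y)]. *)
pose h k : 'rV[R]_n := \row_j (if (j < k)%N then y 0 j else x 0 j).
have hC k : cube (h k) by move=> j; rewrite mxE; case: ifP.
have {1}-> : y = h n by apply/rowP => j; rewrite mxE ltn_ord.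
suff: forall k, (k <= n)%N -> `|evalp p x - evalp p (h k)|
    <= k%:R * (2 * d%:R ^+ 3 * B * norm2 (x - y)) by exact.
elim=> [_|k IHk kn].
  rewrite (_ : h 0%N = x) ?subrr ?normr0 ?mul0r //.
  by apply/rowP => j; rewrite mxE ltn0.
rewrite -natr1 mulrDl mul1r.
rewrite (_ : _ - _ = (evalp p x - evalp p (h k)) +
    (evalp p (h k) - evalp p (h k.+1))); last by rewrite addrA subrK.
apply: (le_trans (ler_normD _ _)); apply: lerD; first exact: IHk (ltnW kn).
pose i := Ordinal kn.
have hkS : set_coord (h k) i (y 0 i) = h k.+1.
  apply/rowP => j; rewrite !mxE ltnS -val_eqE /=; case: eqP => [jk|/eqP jk].
    by rewrite jk leqnn (_ : i = j) //; apply: val_inj.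
  by rewrite [in RHS]leq_eqVlt (negPf jk).
have hk : set_coord (h k) i (x 0 i) = h k.
  apply/rowP => j; rewrite !mxE -val_eqE /=; case: eqP => // jk.
  by rewrite jk ltnn (_ : j = i) //; apply: val_inj.
have := evalp_coord_lipschitz i hp pB (hC k) (hx i) (hy i).
rewrite hkS hk => /le_trans; apply; rewrite ler_wpM2l ?mulr_ge0 ?exprn_ge0 //.
by have := ler_norm_norm2 (x - y) i; rewrite !mxE.
Qed.

(** Monomials are at most 1 in absolute value on the cube. Boundedness is what makes the [sup] in
    [supnorm] a true upper bound. *)
Lemma evalp_cube_bounded p : exists B, forall z, cube z -> `|evalp p z| <= B.
Proof.
exists (\sum_(m <- msupp p) `|p@_m|) => z hz; rewrite /evalp mevalE.
apply: le_trans (ler_norm_sum _ _ _) _; apply: ler_sum => m _.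
rewrite normrM -[leRHS]mulr1 ler_wpM2l // normr_prod prodr_ile1 // => i _.
by rewrite normr_ge0 normrX exprn_ile1 ?normr_ge0 // ler_norml hz.
Qed.

Lemma evalp_le_supnorm p z : cube z -> `|evalp p z| <= supnorm (evalp p).
Proof.
move=> hz; apply: ub_le_sup; last by exists z.
have [B hB] := evalp_cube_bounded p.
by exists B => _ [y hy <-]; exact: hB.
Qed.

Lemma supnorm_evalp_ge0 p : 0 <= supnorm (evalp p).
Proof. exact: le_trans (evalp_le_supnorm p cube0). Qed.

Lemma supnorm_le (f : 'rV[R]_n -> R) (B : R) :
  (forall z, cube z -> `|f z| <= B) -> supnorm f <= B.
Proof.
move=> fB; apply: ge_sup; first by exists `|f 0|, 0 => //; exact: cube0.
by move=> _ [z hz <-]; exact: fB.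
Qed.

End PolynomialsOnCube.

(** * A binomial bound, Cauchy-Schwarz, and diagonalization by congruence *)

Lemma leq_s_dim (n d : nat) : (n * d <= s_dim n d)%N.
Proof.
rewrite /s_dim; elim: n => [|n IHn] //.
case: d IHn => [|d] IHn; first by rewrite muln0.
(* Pascal's rule; the second summand is at least $\binom{d+1}{d} = d+1$. *)
rewrite addSn binS mulSn addnC leq_add //.
by rewrite (leq_trans _ (leq_bin2l _ (leq_addl n _))) // binSn.
Qed.

(** Lagrange's identity: the double sum of the squares $(a_i b_j - a_j b_i)^2$ is twice the gap. *)
Lemma Cauchy_Schwarz_sum (R : realDomainType) (I : finType) (a b : I -> R) :
  (\sum_i a i * b i) ^+ 2 <= (\sum_i a i ^+ 2) * (\sum_i b i ^+ 2).
Proof.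
have : 0 <= \sum_i \sum_j (a i * b j - a j * b i) ^+ 2.
  by apply: sumr_ge0 => i _; apply: sumr_ge0 => j _; exact: sqr_ge0.
rewrite (_ : \sum_i _ = 2 * ((\sum_i a i ^+ 2) * (\sum_i b i ^+ 2)
    - (\sum_i a i * b i) ^+ 2)); first by rewrite pmulr_rge0 // subr_ge0.
pose A := \sum_i a i ^+ 2; pose B := \sum_i b i ^+ 2; pose S := \sum_i a i * b i.
transitivity (\sum_i (a i ^+ 2 * B + b i ^+ 2 * A - 2 * (a i * b i) * S)).
  apply: eq_bigr => i _; rewrite /A /B /S !mulr_sumr -big_split -sumrB /=.
  by apply: eq_bigr => j _; ring.
by rewrite sumrB big_split /= -!mulr_suml -mulr_sumr -/A -/B -/S; ring.
Qed.

(* Induction on the size, clearing the first row and column: [S] is the Schur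
   complement of the (positive) top left entry. *)
Lemma posdef_congruent1 (R : rcfType) (s : nat) (G : 'M[R]_s) :
  G^T = G -> (forall v : 'rV_s, v != 0 -> 0 < (v *m G *m v^T) 0 0) ->
  exists B : 'M_s, B *m G *m B^T = 1%:M.
Proof.
elim: s G => [|s IHs] G; first by exists 0; apply/matrixP => -[].
rewrite -[s.+1]/(1 + s)%N in G *.
move=> Gsym Gpos.
pose e : R := G 0 0; pose h := ursubmx G; pose D := drsubmx G.
have GE : G = block_mx e%:M h h^T D.
  rewrite -[G in LHS]submxK; congr block_mx.
    apply/matrixP => i j; rewrite !mxE !ord1 eqxx mulr1n.
    by congr (G _ _); apply: val_inj.
  by rewrite trmx_ursub Gsym.
have Dsym : D^T = D by rewrite trmx_drsub Gsym.
have e0 : 0 < e.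
  have := Gpos (row_mx 1%:M 0); rewrite GE tr_row_mx trmx1 trmx0.
  rewrite mul_row_block mul_row_col !mul1mx !mul0mx !mulmx1 !mulmx0 !addr0.
  rewrite !mxE eqxx mulr1n; apply; apply/eqP => /matrixP/(_ 0 0).
  rewrite !mxE; case: splitP => // j _; rewrite !mxE ord1 eqxx mulr1n.
  by apply/eqP; rewrite oner_eq0.
have eK (x : R) : e * (- e^-1 * x) + x = 0.
  by rewrite mulrA mulrN divff ?gt_eqF // mulN1r addNr.
pose E : 'M_(1 + s) := block_mx 1%:M 0 (- e^-1 *: h^T) 1%:M.
pose S := D - e^-1 *: (h^T *m h).
have EG : E *m G *m E^T = block_mx e%:M 0 0 S.
  rewrite /E [in LHS]GE tr_block_mx !trmx1 trmx0 linearZ /= trmxK !mulmx_block.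
  rewrite !mul1mx !mul0mx !mulmx0 !mulmx1 !addr0.
  have -> : - e^-1 *: h^T *m e%:M + h^T = 0.
    rewrite mul_mx_scalar; apply/matrixP => i j; rewrite !mxE; exact: eK.
  rewrite mul0mx add0r; congr block_mx; last by rewrite -scalemxAl scaleNr addrC.
  by rewrite mul_scalar_mx; apply/matrixP => i j; rewrite !mxE; exact: eK.
have [|v v0|B BS] := IHs S.
- by rewrite /S linearB linearZ /= trmx_mul trmxK Dsym.
(* The form of [S] at [v] is that of [G] at [row_mx 0 v *m E], whose right block is [v], hence
   nonzero. *)
- have <- : row_mx 0 v *m E *m G *m (row_mx 0 v *m E)^T = v *m S *m v^T.
    transitivity (row_mx 0 v *m (E *m G *m E^T) *m (row_mx 0 v)^T).
      by rewrite trmx_mul !mulmxA.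
    rewrite EG tr_row_mx trmx0 mul_row_block mul_row_col.
    by rewrite !mulmx0 ?mul0mx !add0r.
  apply: Gpos; rewrite mul_row_block !mulmx1 ?mulmx0 ?mul0mx !add0r.
  apply: contra v0 => /eqP/(congr1 rsubmx); rewrite row_mxKr => ->.
  by apply/eqP/rowP => i; rewrite !mxE.
(* [F] normalizes the pivot and applies the inductive matrix to the Schur complement. *)
pose F : 'M_(1 + s) := block_mx (Num.sqrt e)^-1%:M 0 0 B.
exists (F *m E); transitivity (F *m (E *m G *m E^T) *m F^T).
  by rewrite trmx_mul !mulmxA.
rewrite EG /F tr_block_mx !trmx0 !mulmx_block !mulmx0 !mul0mx !addr0 !add0r.
rewrite BS tr_scalar_mx -!scalar_mxM (scalar_mx_block 1 s).
have e1 : Num.sqrt e != 0 by rewrite gt_eqF // sqrtr_gt0.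
rewrite -[X in _ * X * _](sqr_sqrtr (ltW e0)) expr2 mulrA mulVf // mul1r.
by rewrite divff // !mul0mx.
Qed.

(** * Orthonormal bases and the variational property of the Christoffel polynomial *)

Section Christoffel.
Variables (R : realType) (n d N : nat) (X : N.-tuple 'rV[R]_n).
Implicit Types (p q : {mpoly R[n]}) (x : 'rV[R]_n).
Local Notation I := 'X_{1..n < d.+1}.

Lemma evalp_comb (J : finType) (c : J -> R) (F : J -> {mpoly R[n]}) x :
  evalp (\sum_j c j *: F j) x = \sum_j c j * evalp (F j) x.
Proof.
by rewrite /evalp raddf_sum /=; apply: eq_bigr => j _; rewrite mevalZ.
Qed.

Lemma evalp_sum_sqr (J : finType) (F : J -> {mpoly R[n]}) x :
  evalp (\sum_j F j ^+ 2) x = \sum_j evalp (F j) x ^+ 2.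
Proof.
by rewrite /evalp raddf_sum /=; apply: eq_bigr => j _; rewrite !expr2 mevalM.
Qed.

Lemma deg_le_comb (J : finType) (c : J -> R) (F : J -> {mpoly R[n]}) :
  (forall j, deg_le d (F j)) -> deg_le d (\sum_j c j *: F j).
Proof.
move=> hF; apply: (big_ind (fun p => deg_le d p)) => [|p q|j _].
- by rewrite /deg_le /= msize0.
- by rewrite /deg_le /= => hp hq; apply: leq_trans (msizeD_le _ _) _;
    rewrite geq_max hp.
- exact: leq_trans (msizeZ_le _ _) (hF j).
Qed.

Lemma sample_innerC p q : sample_inner X p q = sample_inner X q p.
Proof.
by rewrite /sample_inner; under eq_bigr do rewrite mulrC.
Qed.

Lemma sample_inner_combl (J : finType) (c : J -> R) (F : J -> {mpoly R[n]}) q :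
  sample_inner X (\sum_j c j *: F j) q = \sum_j c j * sample_inner X (F j) q.
Proof.
rewrite /sample_inner; under eq_bigr do rewrite evalp_comb mulr_suml.
rewrite exchange_big /= mulr_sumr; apply: eq_bigr => j _.
rewrite mulrCA; congr (_ * _); rewrite mulr_sumr.
by apply: eq_bigr => i _; rewrite mulrA.
Qed.

Lemma sample_inner_comb (J K : finType) (c : J -> R) (F : J -> {mpoly R[n]})
    (e : K -> R) (H : K -> {mpoly R[n]}) :
  sample_inner X (\sum_j c j *: F j) (\sum_k e k *: H k)
  = \sum_j \sum_k c j * e k * sample_inner X (F j) (H k).
Proof.
rewrite sample_inner_combl; apply: eq_bigr => j _.
rewrite sample_innerC sample_inner_combl mulr_sumr; apply: eq_bigr => k _.
by rewrite mulrA sample_innerC.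
Qed.

Lemma orthonormal_comb (b : I -> {mpoly R[n]}) (c e : I -> R) :
  (forall a a', sample_inner X (b a) (b a') = (a == a')%:R) ->
  sample_inner X (\sum_a c a *: b a) (\sum_a e a *: b a) = \sum_a c a * e a.
Proof.
move=> bo; rewrite sample_inner_comb; apply: eq_bigr => a _.
rewrite (bigD1 a) //= bo eqxx mulr1 big1 ?addr0 // => a' aa'.
by rewrite bo eq_sym (negPf aa') mulr0.
Qed.

(** Non-degeneracy makes the Gram matrix [G] of the monomials positive definite; the rows of [B]
    with $B G B^T = 1$ are the coefficients of an orthonormal basis. *)
Lemma exists_orthonormal_basis : nondegenerate_upto d X ->
  exists b : I -> {mpoly R[n]}, sample_orthonormal_basis X b.
Proof.
move=> hX; pose s := #|{: I}|.
pose mon (j : 'I_s) : {mpoly R[n]} := 'X_[enum_val j : I].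
pose G : 'M[R]_s := \matrix_(j, k) sample_inner X (mon j) (mon k).
have monE (a : I) : mon (enum_rank a) = 'X_[a] by rewrite /mon enum_rankK.
have mon_deg j : deg_le d (mon j) by rewrite /deg_le /= msizeX bmdeg.
have innerE (v w : 'rV[R]_s) :
  (v *m G *m w^T) 0 0 =
  sample_inner X (\sum_j v 0 j *: mon j) (\sum_j w 0 j *: mon j).
  rewrite sample_inner_comb mxE; under eq_bigr do rewrite !mxE mulr_suml.
  rewrite exchange_big /=; apply: eq_bigr => j _; apply: eq_bigr => k _.
  by rewrite !mxE mulrAC.
have [||B BG] := @posdef_congruent1 R s G.
- by apply/matrixP => j k; rewrite !mxE sample_innerC.
- move=> v v0; rewrite innerE; apply: hX; first exact: deg_le_comb.
  (* Monomials are independent: the coefficients of the zero polynomial give back [v]. *)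
  apply: contra v0 => /eqP vE; apply/eqP/rowP => j; rewrite [RHS]mxE.
  have := congr1 (mcoeff (enum_val j : I)) vE; rewrite mcoeff0 raddf_sum /=.
  rewrite (bigD1 j) //= mcoeffZ mcoeffX eqxx mulr1 big1 ?addr0 // => k kj.
  rewrite mcoeffZ mcoeffX; case: eqP => [/val_inj/enum_val_inj kj'|_].
    by rewrite kj' eqxx in kj.
  by rewrite mulr0.
pose b (a : I) := \sum_j B (enum_rank a) j *: mon j.
have bo a a' : sample_inner X (b a) (b a') = (a == a')%:R.
  have /matrixP/(_ (enum_rank a) (enum_rank a')) := BG.
  rewrite [RHS]mxE (inj_eq enum_rank_inj) => <-.
  have := innerE (row (enum_rank a) B) (row (enum_rank a') B).
  rewrite /b; under eq_bigr do rewrite mxE.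
  under [X in sample_inner _ _ X]eq_bigr do rewrite mxE.
  move=> <-; rewrite -row_mul tr_row !mxE.
  by apply: eq_bigr => k _; rewrite !mxE.
exists b; split=> //; split=> [a|p hp]; first exact: deg_le_comb.
have [Bu _] : B \in unitmx /\ G *m B^T \in unitmx.
  by apply: mulmx1_unit; rewrite mulmxA.
pose v : 'rV[R]_s := \row_j p@_(enum_val j : I).
(* Change of basis from the monomial coefficients [v], possible since [B] is invertible. *)
pose c : {ffun I -> R} := [ffun a : I => (v *m invmx B) 0 (enum_rank a)].
have pE : p = \sum_a c a *: b a.
  transitivity (\sum_j v 0 j *: mon j).
    rewrite {1}(mpolywE hp) [RHS](reindex (@enum_rank I)) /=; last first.
      by apply: onW_bij; exact: enum_rank_bij.
    by apply: eq_bigr => a _; rewrite mxE monE enum_rankK.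
  rewrite -[v in LHS](mulmxKV Bu).
  under [RHS]eq_bigr do rewrite ffunE scaler_sumr.
  rewrite exchange_big /=; apply: eq_bigr => j _.
  rewrite mxE scaler_suml (reindex (@enum_rank I)) /=; last first.
    by apply: onW_bij; exact: enum_rank_bij.
  by apply: eq_bigr => a _; rewrite scalerA.
(* Uniqueness: orthonormality forces each coordinate to be an inner product with [p]. *)
have coefE (e : {ffun I -> R}) a : p = \sum_a e a *: b a ->
    e a = sample_inner X p (b a).
  move=> ->; rewrite sample_inner_combl (bigD1 a) //= bo eqxx mulr1 big1 ?addr0 //.
  by move=> a' /negPf aa'; rewrite bo aa' mulr0.
by exists c; split=> // c' cE; apply/ffunP => a; rewrite !coefE.
Qed.

(** [xget] returns its default 0 only on an empty set, which the existence of an orthonormal basis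
    rules out. *)
Lemma christoffelE : nondegenerate_upto d X ->
  exists2 b : I -> {mpoly R[n]}, sample_orthonormal_basis X b &
    christoffel d X = \sum_a b a ^+ 2.
Proof.
move=> /exists_orthonormal_basis[b hb].
have [|b' hb' b'E] := @xgetPex _ 0 [set \sum_a b a ^+ 2 |
  b in @sample_orthonormal_basis R n d N X]; last by exists b'.
by exists (\sum_a b a ^+ 2), b.
Qed.

Hypothesis hX : nondegenerate_upto d X.
Local Notation P := (evalp (christoffel d X)).

(** Expand [p] in an orthonormal basis: the squared coordinates sum to the squared norm of [p], and
    Cauchy-Schwarz bounds the value at [x]. *)
Lemma evalp_sqr_le_christoffel p x : deg_le d p ->
  evalp p x ^+ 2 <= sample_inner X p p * P x.
Proof.
have [b [[_ bb] bo] ->] := christoffelE hX.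
move=> /bb[c [-> _]]; rewrite orthonormal_comb // evalp_comb.
rewrite evalp_sum_sqr; under [X in X * _]eq_bigr do rewrite -expr2.
exact: Cauchy_Schwarz_sum.
Qed.

(** The reproducing kernel $\sum_a b_a(x) b_a$, the equality case of the preceding inequality. *)
Lemma exists_christoffel_kernel x : exists q,
  [/\ deg_le d q, evalp q x = P x & sample_inner X q q = P x].
Proof.
have [b [[bd _] bo] ->] := christoffelE hX.
have E : evalp (\sum_a b a ^+ 2) x = \sum_a evalp (b a) x * evalp (b a) x.
  by rewrite evalp_sum_sqr; under eq_bigr do rewrite expr2.
exists (\sum_a evalp (b a) x *: b a); split; first exact: deg_le_comb.
  by rewrite E evalp_comb.
by rewrite E orthonormal_comb.
Qed.

Lemma christoffel_gt0 x : 0 < P x.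
Proof.
(* The variational inequality at the constant 1 reads $1 \le \langle 1,1\rangle P(x)$. *)
have h1 : deg_le d (1 : {mpoly R[n]}) by rewrite /deg_le /= msize1.
have := evalp_sqr_le_christoffel x h1.
rewrite /evalp meval1 expr1n => h; have := lt_le_trans ltr01 h.
by rewrite pmulr_rgt0 // hX ?oner_eq0.
Qed.

End Christoffel.

(** * Sample means and optimal transport *)

Section Transport.
Variables (R : realType) (n : nat).
Implicit Types f : 'rV[R]_n -> R.

Definition sample_mean (N : nat) (X : N.-tuple 'rV[R]_n) f : R :=
  N%:R^-1 * \sum_(i < N) f (tnth X i).

(** Grouping equal samples links sums over the support, used by couplings, to sums over samples. *)
Lemma sum_empirical (N : nat) (X : N.-tuple 'rV[R]_n) f :
  \sum_(x <- undup X) empirical X x * f x = sample_mean X f.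
Proof.
rewrite /sample_mean; under eq_bigr do rewrite /empirical -mulrA mulr_suml.
rewrite -mulr_sumr exchange_big /=; congr (_ * _); apply: eq_bigr => i _.
rewrite (bigD1_seq (tnth X i)) ?undup_uniq ?mem_undup ?mem_tnth //=.
rewrite eqxx mul1r big1 ?addr0 // => x; rewrite eq_sym => /negPf ->.
by rewrite mul0r.
Qed.

Lemma sample_mean1 (N : nat) (X : N.-tuple 'rV[R]_n) :
  (0 < N)%N -> sample_mean X (fun=> 1) = 1.
Proof.
by move=> N0; rewrite /sample_mean sumr_const card_ord mulVf // pnatr_eq0 -lt0n.
Qed.

(** The product measure is a coupling, so the [inf] defining [wasserstein] is over a nonempty
    set. *)
Lemma coupling_nonempty (N M : nat) (X : N.-tuple 'rV[R]_n)
    (Y : M.-tuple 'rV[R]_n) :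
  (0 < N)%N -> (0 < M)%N -> coupling X Y !=set0.
Proof.
move=> N0 M0; exists (fun x y => empirical X x * empirical Y y); split.
- by move=> x y _ _; rewrite !mulr_ge0 ?invr_ge0 ?sumr_ge0.
- move=> x _; rewrite -mulr_sumr -[RHS]mulr1 -[in RHS](sample_mean1 Y M0).
  by rewrite -sum_empirical; under [in RHS]eq_bigr do rewrite mulr1.
- move=> y _; rewrite -mulr_suml -[RHS]mul1r -[in RHS](sample_mean1 X N0).
  by rewrite -sum_empirical; under [in RHS]eq_bigr do rewrite mulr1.
Qed.

Variables (N M : nat) (X : N.-tuple 'rV[R]_n) (Y : M.-tuple 'rV[R]_n).

Lemma transport_cost_ge0 g : coupling X Y g -> 0 <= transport_cost X Y g.
Proof.
move=> [g0 _ _]; rewrite /transport_cost big_seq sumr_ge0 // => x.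
rewrite mem_undup => xX; rewrite big_seq sumr_ge0 // => y.
by rewrite mem_undup => yY; rewrite mulr_ge0 ?norm2_ge0 ?g0.
Qed.

Lemma sample_meanB_coupling g f : coupling X Y g ->
  sample_mean X f - sample_mean Y f =
  \sum_(x <- undup X) \sum_(y <- undup Y) g x y * (f x - f y).
Proof.
move=> [_ gX gY]; rewrite -!sum_empirical.
under [RHS]eq_bigr do (under eq_bigr do rewrite mulrBr; rewrite sumrB).
rewrite sumrB; congr (_ - _).
  rewrite big_seq [RHS]big_seq; apply: eq_bigr => x.
  by rewrite mem_undup => xX; rewrite -mulr_suml gX.
rewrite exchange_big /= big_seq [RHS]big_seq; apply: eq_bigr => y.
by rewrite mem_undup => yY; rewrite -mulr_suml gY.
Qed.

Hypotheses (N0 : (0 < N)%N) (M0 : (0 < M)%N).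

Lemma le_wasserstein (L c : R) : 0 <= L ->
  (forall g, coupling X Y g -> c <= L * transport_cost X Y g) ->
  c <= L * wasserstein X Y.
Proof.
have [g0 hg0] := coupling_nonempty X Y N0 M0.
(* For $L = 0$ one coupling gives $c \le 0$; otherwise dividing by [L] makes [c / L] a lower bound
   of the costs. *)
rewrite le_eqVlt => /predU1P[<-|L0] cL.
  by have := cL _ hg0; rewrite !mul0r.
rewrite mulrC -ler_pdivrMr //; apply: lb_le_inf.
  by exists (transport_cost X Y g0), g0.
by move=> _ [g hg <-]; rewrite ler_pdivrMr // mulrC cL.
Qed.

Lemma wasserstein_ge0 : 0 <= wasserstein X Y.
Proof.
rewrite -[leRHS]mul1r; apply: le_wasserstein => // g hg.
by rewrite mul1r transport_cost_ge0.
Qed.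

(** The easy half of Kantorovich-Rubinstein duality: by the marginal conditions the difference of
    means is an integral of $f(x) - f(y)$ against any coupling. *)
Lemma sample_mean_wasserstein f (L : R) : 0 <= L ->
  (forall x y, x \in X -> y \in Y -> `|f x - f y| <= L * norm2 (x - y)) ->
  `|sample_mean X f - sample_mean Y f| <= L * wasserstein X Y.
Proof.
move=> L0 fL; apply: le_wasserstein => // g hg.
rewrite (sample_meanB_coupling f hg); have [g0 _ _] := hg.
apply: le_trans (ler_norm_sum _ _ _) _.
rewrite /transport_cost mulr_sumr big_seq [leRHS]big_seq; apply: ler_sum => x.
rewrite mem_undup => xX; apply: le_trans (ler_norm_sum _ _ _) _.
rewrite mulr_sumr big_seq [leRHS]big_seq; apply: ler_sum => y.
rewrite mem_undup => yY; rewrite normrM ger0_norm ?g0 // mulrCA.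
by rewrite ler_wpM2l ?g0 ?fL.
Qed.

End Transport.

(** * Pointwise comparison of two Christoffel polynomials *)

Lemma nondegenerate_size_gt0 (R : realType) (n d N : nat)
    (X : N.-tuple 'rV[R]_n) : nondegenerate_upto d X -> (0 < N)%N.
Proof.
case: N X => // X0 hX; have := hX 1.
rewrite /deg_le /= msize1 oner_eq0 => /(_ isT isT).
by rewrite /sample_inner invr0 mul0r ltxx.
Qed.

(** [W] is abstract so that the lemma applies with the samples exchanged and the same [W], without
    proving [wasserstein] symmetric. *)
Lemma christoffel_ratio (R : realType) (n d N M : nat)
    (X : N.-tuple 'rV[R]_n) (Y : M.-tuple 'rV[R]_n) (W : R) x :
  nondegenerate_upto d X -> nondegenerate_upto d Y -> 0 <= W ->
  (forall (f : 'rV[R]_n -> R) (L : R), 0 <= L ->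
     (forall y z, cube y -> cube z -> `|f y - f z| <= L * norm2 (y - z)) ->
     `|sample_mean X f - sample_mean Y f| <= L * W) ->
  cube x ->
  evalp (christoffel d Y) x <= evalp (christoffel d X) x *
    (Cnd R n d * supnorm (evalp (christoffel d Y)) * W + 1).
Proof.
move=> hX hY W0 hW hx.
set S := supnorm _; set P := evalp (christoffel d X) x.
have [q [qd qx qq]] := exists_christoffel_kernel hY x.
set p := evalp (christoffel d Y) x in qx qq *.
have p0 : 0 < p := christoffel_gt0 hY x.
have S0 : 0 <= S := supnorm_evalp_ge0 _.
(* Bound for the kernel on the cube: $q^2 \le \langle q,q\rangle_Y P_Y \le p S$. *)
pose B := Num.sqrt (p * S).
have B2 : B * B = p * S by rewrite -expr2 sqr_sqrtr // mulr_ge0 // ltW.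
have qB z : cube z -> `|evalp q z| <= B.
  move=> hz; rewrite -sqrtr_sqr ler_wsqrtr //.
  apply: le_trans (evalp_sqr_le_christoffel hY z qd) _.
  rewrite qq ler_wpM2l ?(ltW p0) //.
  exact: le_trans (ler_norm _) (evalp_le_supnorm _ hz).
(* Lipschitz constant of $q^2$: the difference of squares has one factor with constant $2 n d^3 B$
   and one of size at most $2B$, where $B^2 = pS$. *)
pose L := 4 * n%:R * d%:R ^+ 3 * (p * S).
have L0 : 0 <= L by rewrite !mulr_ge0 ?exprn_ge0 // ltW.
have hL y z : cube y -> cube z ->
    `|evalp q y * evalp q y - evalp q z * evalp q z| <= L * norm2 (y - z).
  move=> hy hz; rewrite -!expr2 subr_sqr normrM.
  rewrite (_ : L * _ = n%:R * (2 * d%:R ^+ 3 * B * norm2 (y - z)) * (B + B)).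
    apply: ler_pM => //; first exact: evalp_lipschitz.
    by apply: le_trans (ler_normD _ _) _; rewrite lerD ?qB.
  by rewrite /L -B2; ring.
have qqX : sample_inner X q q <= p + L * W.
  have : `|sample_inner X q q - sample_inner Y q q| <= L * W := hW _ _ L0 hL.
  by rewrite qq => /(le_trans (ler_norm _)); rewrite lerBlDl.
have P0 : 0 < P := christoffel_gt0 hX x.
have : p * p <= (p + L * W) * P.
  rewrite -expr2 -[in leLHS]qx.
  apply: le_trans (evalp_sqr_le_christoffel hX x qd) _.
  by rewrite ler_wpM2r // ltW.
(* [L] carries a factor [p], so one [p] cancels from both sides. *)
rewrite (_ : (p + L * W) * P =
  p * (P * (4 * n%:R * d%:R ^+ 3 * S * W + 1))); last by rewrite /L; ring.
rewrite ler_pM2l // => /le_trans; apply.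
rewrite ler_pM2l // lerD2r ler_wpM2r // ler_wpM2r //.
(* Split $n d^3 = (nd) d^2$ and use $nd \le s(n,d)$. *)
rewrite /Cnd exprS -!mulrA ler_pM2l // mulrA ler_wpM2r ?exprn_ge0 //.
by rewrite -natrM ler_nat leq_s_dim.
Qed.

(** After clearing the positive factor [ln 10], each half of the absolute value is the logarithm of
    one of the two comparisons. *)
Lemma normr_log10B_le (R : realType) (a b K : R) : 0 < a -> 0 < b -> 0 < K ->
  a <= b * K -> b <= a * K -> `|log10 a - log10 b| <= log10 K.
Proof.
move=> a0 b0 K0 abK baK.
have ln10 : 0 < ln 10%:R :> R by rewrite ln_gt0 // ltr1n.
rewrite /log10 -mulrBl normrM [X in _ * X]ger0_norm ?invr_ge0 ?(ltW ln10) //.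
rewrite ler_pM2r ?invr_gt0 // ler_norml lerNl opprB !lerBlDl.
by rewrite -!lnM ?posrE // !ler_ln ?posrE ?mulr_gt0 // abK baK.
Qed.

Theorem proposition18 (R : realType) (n d N M : nat)
    (X : N.-tuple 'rV[R]_n) (Y : M.-tuple 'rV[R]_n)
    (hn : (1 <= n)%N)
    (hXcube : forall x : 'rV[R]_n, x \in X -> @cube R n x)
    (hYcube : forall y : 'rV[R]_n, y \in Y -> @cube R n y)
    (hX : nondegenerate_upto d X) (hY : nondegenerate_upto d Y) :
  supnorm (fun x : 'rV[R]_n =>
      log10 (evalp (christoffel d X) x) - log10 (evalp (christoffel d Y) x))
  <= log10 (Cnd R n d
            * Num.max (supnorm (evalp (christoffel d X)))
                      (supnorm (evalp (christoffel d Y)))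
            * wasserstein X Y + 1).
Proof.
have N0 := nondegenerate_size_gt0 hX; have M0 := nondegenerate_size_gt0 hY.
have W0 := wasserstein_ge0 X Y N0 M0.
set W := wasserstein X Y in W0 *.
have hW (f : 'rV[R]_n -> R) (L : R) : 0 <= L ->
    (forall y z, cube y -> cube z -> `|f y - f z| <= L * norm2 (y - z)) ->
    `|sample_mean X f - sample_mean Y f| <= L * W.
  move=> L0 fL; apply: sample_mean_wasserstein => // x y xX yY.
  by apply: fL; [exact: hXcube | exact: hYcube].
have hW' (f : 'rV[R]_n -> R) (L : R) : 0 <= L ->
    (forall y z, cube y -> cube z -> `|f y - f z| <= L * norm2 (y - z)) ->
    `|sample_mean Y f - sample_mean X f| <= L * W.
  by move=> L0 fL; rewrite distrC hW.
set m := Num.max _ _.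
have C0 : 0 <= Cnd R n d by rewrite /Cnd !mulr_ge0 ?exprn_ge0.
have m0 : 0 <= m by rewrite le_max supnorm_evalp_ge0.
(* The two ratio bounds involve different supremum norms; both are enlarged to the maximum to share
   one factor. *)
have le_bound (P S : R) : 0 < P -> S <= m ->
    P * (Cnd R n d * S * W + 1) <= P * (Cnd R n d * m * W + 1).
  by move=> P0 Sm; rewrite ler_pM2l // lerD2r ler_wpM2r // ler_wpM2l.
apply: supnorm_le => x hx; apply: normr_log10B_le.
- exact: christoffel_gt0.
- exact: christoffel_gt0.
- by rewrite ltr_wpDl // !mulr_ge0.
- apply: le_trans (christoffel_ratio hY hX W0 hW' hx) (le_bound _ _ _ _).
    exact: christoffel_gt0.
  by rewrite le_max lexx.
- apply: le_trans (christoffel_ratio hX hY W0 hW hx) (le_bound _ _ _ _).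
    exact: christoffel_gt0.
  by rewrite le_max lexx orbT.
Qed.
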